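(* Let $V$ be a finite ground set with $n=|V|$, let $f:2^V\to\mathbb{R}$ be non-negative and submodular (not necessarily monotone or normalized), let $k$ be an integer with $k\ge2$ and $n\ge 3k$, and let $A^*$ be an optimal solution of $\max\{f(S): S\subseteq V,\ |S|\le k\}$. Let $1/\mathrm{e}\le\epsilon<1$ and let $A$ be the output of the Stochastic Greedy algorithm with parameter $\epsilon$ (described in the context). Then \[ \mathbb{E}[f(A)]\ \ge\ \left(\epsilon-2\cdot\frac{k-1}{n-k}\right)(1-\epsilon)\,f(A^* ). \] In particular, with $\epsilon=\frac12+\frac{k-1}{n-k}$, \[ \mathbb{E}[f(A)]\ \ge\ \frac14\left(1-2\cdot\frac{k-1}{n-k}\right)^2 f(A^* ). \]
   Context: Stochastic Greedy algorithm with parameter $\epsilon$: let $s=\frac{n}{k}\ln\frac{1}{\epsilon}$. Set $A_0=\emptyset$. For $i=1,\dots,k$: obtain $R$ by sampling $\lceil s\rceil$ elements uniformly at random without replacement from $V\setminus A_{i-1}$; let $a_i\in\arg\max_{a\in R}\bigl(f(A_{i-1}\cup\{a\})-f(A_{i-1})\bigr)$; if $f(A_{i-1}\cup\{a_i\})-f(A_{i-1})>0$ set $A_i=A_{i-1}\cup\{a_i\}$, otherwise set $A_i=A_{i-1}$. The output is $A=A_k$. Expectations are over the randomness of the algorithm. *)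

(* Defs.v *)
From HB Require Import structures.
From mathcomp Require Import all_boot all_order all_algebra.
From mathcomp Require Import reals exp.
Set Implicit Arguments.
Unset Strict Implicit.
Unset Printing Implicit Defensive.
Import Order.TTheory GRing.Theory Num.Theory.
Local Open Scope ring_scope.

Definition submodular (R : realType) (V : finType) (f : {set V} -> R) : Prop :=
  forall A B : {set V}, f (A :|: B) + f (A :&: B) <= f A + f B.

Definition optimal_solution (R : realType) (V : finType) (f : {set V} -> R)
    (k : nat) (Astar : {set V}) : Prop :=
  (#|Astar| <= k)%N /\ forall S : {set V}, (#|S| <= k)%N -> f S <= f Astar.

Definition gain (R : realType) (V : finType) (f : {set V} -> R)
    (A : {set V}) (a : V) : R := f (a |: A) - f A.

Definition argmax_gain (R : realType) (V : finType) (f : {set V} -> R)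
    (A S : {set V}) : {set V} :=
  [set a in S | [forall b in S, gain f A b <= gain f A a]].

(* The ceiling is a nonnegative integer when 0 < eps <= 1, so taking its
   absolute value is only a cast to nat. *)
Definition sample_size (R : realType) (n k : nat) (eps : R) : nat :=
  `|Num.ceil (n%:R / k%:R * ln (1 / eps))|%N.

Definition samples (V : finType) (m : nat) (A : {set V}) : {set {set V}} :=
  [set S : {set V} | (S \subset ~: A) && (#|S| == m)].

(* The first i iterations of the algorithm are recorded as the sequence of
   pairs (R_j, a_j), most recent first: [:: (R_i, a_i); ...; (R_1, a_1)]. *)
Definition history (V : finType) := seq ({set V} * V).

Definition greedy_step (R : realType) (V : finType) (f : {set V} -> R)
    (A : {set V}) (a : V) : {set V} :=
  if 0 < gain f A a then a |: A else A.

Fixpoint current_set (R : realType) (V : finType) (f : {set V} -> R)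
    (h : history V) : {set V} :=
  if h is (_, a) :: h' then greedy_step f (current_set f h') a else set0.

(* How a_i is picked among several maximizers is left open by the algorithm.
   The choice may be randomized and may depend on all that happened before:
   tb h S a is the probability of picking a when the past is h and the current
   sample is S.  A deterministic choice is the case of values in {0, 1}.
   The empty sample, which has no maximizer, is excluded. *)
Definition tie_breaking (R : realType) (V : finType) (f : {set V} -> R)
    (tb : history V -> {set V} -> V -> R) : Prop :=
  forall (h : history V) (S : {set V}), S != set0 ->
    [/\ forall a, 0 <= tb h S a,
        \sum_(a : V) tb h S a = 1
      & forall a, tb h S a != 0 -> a \in argmax_gain f (current_set f h) S].

(* B is uniform among the m-subsets of the complement of the current set;
   the law has total mass 1 as long as m does not exceed the size of that
   complement, which holds along the first k iterations if 1/e <= eps < 1 and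
   n >= 3k. *)
Fixpoint history_prob (R : realType) (V : finType) (f : {set V} -> R) (m : nat)
    (tb : history V -> {set V} -> V -> R) (h : history V) : R :=
  if h is (B, a) :: h' then
    let Om := samples m (current_set f h') in
    history_prob f m tb h' * ((B \in Om)%:R / #|Om|%:R) * tb h' B a
  else 1.

(* E[f(A)]: there are finitely many possible runs, so the expectation is the
   sum over all of them. *)
Definition expected_greedy_value (R : realType) (V : finType)
    (f : {set V} -> R) (k : nat) (eps : R)
    (tb : history V -> {set V} -> V -> R) : R :=
  \sum_(h : k.-tuple ({set V} * V)%type)
    history_prob f (sample_size #|V| k eps) tb h * f (current_set f h).

(* Main.v *)
(* Write O for the optimal set, A for the current set, n = |V|, m for the
   sample size, L = ln(1/eps), a = 1 - L/k and c = (1 - eps)/k.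
   By symmetry, the mean gain over the sampled part of O \ A is, up to the
   probability of hitting O \ A, the mean gain over O \ A; since the sample
   misses a set of size o <= k with probability at most
   a^o <= 1 - c o, one step satisfies
     E[f(A')] >= f(A) + c (f(O u A) - f(A)).
   Each element is picked with probability at most m / |V \ A|, which is at
   most L/k + d with d = 2/(n - k), and a random addition of this kind costs a
   nonnegative submodular function at most that fraction of its value, so
     E[f(O u A_i)] >= max(0, a - d)^i f(O) >= (a^i - i d) f(O).
   As 1 - c >= a, unrolling the first recurrence gives
     E[f(A_k)] >= k c (a^(k-1) - (k-1) d) f(O),
   and a^(k-1) >= eps because L <= 1. *)
Require Import Defs.
From HB Require Import structures.
From mathcomp Require Import all_boot all_order all_algebra perm.
From mathcomp Require Import reals sequences exp.
From mathcomp Require Import ring lra.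
Set Implicit Arguments.
Unset Strict Implicit.
Unset Printing Implicit Defensive.
Import Order.TTheory GRing.Theory Num.Theory.
Local Open Scope ring_scope.

(** * Submodularity and counting of samples *)

(** Elements of [N] are removed one at a time; submodularity for [(N :\ x) :|: A] and [x |: A],
    which meet in [A], bounds the loss by the gain of [x] over [A]. [N] may meet [A], where gains
    are 0. *)
Lemma submodular_gain_sum (R : realType) (V : finType) (f : {set V} -> R)
    (A N : {set V}) :
  submodular f -> f (N :|: A) - f A <= \sum_(x in N) gain f A x.
Proof.
move=> fS; elim: {N}#|N| {-2}N (leqnn #|N|) => [|n IH] N.
  by rewrite leqn0 cards_eq0 => /eqP->; rewrite set0U subrr big_set0.
have [->|[x xN]] := set_0Vmem N; first by rewrite set0U subrr big_set0.
move=> leN; rewrite (big_setD1 x xN) /=.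
have := IH (N :\ x); rewrite (cardsD1 x) xN in leN => /(_ leN) IHx.
have := fS ((N :\ x) :|: A) (x |: A).
have -> : (N :\ x) :|: A :|: (x |: A) = N :|: A.
  by rewrite setUACA setUid (setUC _ [set x]) setD1K.
have -> : ((N :\ x) :|: A) :&: (x |: A) = A.
  apply/setP => y; rewrite !inE.
  by case: (y == x); case: (y \in A); rewrite ?andbF ?orbT.
by rewrite /gain; lra.
Qed.

Lemma card_samples_avoid (V : finType) (m : nat) (A O : {set V}) :
  O \subset ~: A ->
  #|[set S in samples m A | [disjoint S & O]]| = 'C(#|~: A| - #|O|, m).
Proof.
move=> OA; have <- : #|~: A :\: O| = (#|~: A| - #|O|)%N.
  by rewrite cardsD (setIidPr OA).
rewrite -cards_draws; congr #|pred_of_set _|; apply/setP => S.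
rewrite !inE subsetD.
by case: (S \subset _); case: [disjoint _ & _]; rewrite ?andbF ?andbT.
Qed.

Lemma card_samples (V : finType) (m : nat) (A : {set V}) :
  #|samples m A| = 'C(#|~: A|, m).
Proof. by rewrite -cards_draws; apply: eq_card => S; rewrite !inE. Qed.

(** An element outside [A] is sampled with probability [m / #|~: A|], in product form. The samples
    missing [x] are counted by a binomial coefficient, and the others are the complement. *)
Lemma card_samples_mem (V : finType) (m : nat) (A : {set V}) (x : V) :
  x \in ~: A ->
  (#|[set S in samples m A | x \in S]| * #|~: A| = m * #|samples m A|)%N.
Proof.
move=> xA; have [lt|le] := ltnP #|~: A| m.
  have s0 : samples m A = set0.
    by apply/eqP; rewrite -cards_eq0 card_samples bin_small.
  rewrite s0 cards0 muln0 (_ : [set _ in _ | _] = set0) ?cards0 //.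
  by apply/setP => S; rewrite !inE.
have := @card_samples_avoid V m A [set x].
rewrite sub1set => /(_ xA); rewrite cards1 subn1 => av.
have := cardsID [set S : {set V} | x \in S] (samples m A).
have -> : samples m A :&: [set S : {set V} | x \in S]
    = [set S in samples m A | x \in S].
  by apply/setP => S; rewrite !inE.
have -> : samples m A :\: [set S : {set V} | x \in S]
    = [set S in samples m A | [disjoint S & [set x]]].
  by apply/setP => S; rewrite !inE disjoint_sym disjoints1 andbC.
rewrite av => tot.
have := mul_bin_down #|~: A| m; rewrite -card_samples => mb.
have : (#|[set S in samples m A | x \in S]| * #|~: A|
    + (#|~: A| - m) * #|samples m A| = #|~: A| * #|samples m A|)%N.
  by rewrite -mb -tot mulnDr (mulnC _ #|~: A|).
rewrite mulnBl => H; apply/eqP.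
rewrite -(eqn_add2r (#|~: A| * #|samples m A| - m * #|samples m A|)) H.
by rewrite subnKC // leq_mul2r le orbT.
Qed.

(** Shrinking a pool of size [M] by one multiplies the number of [m]-subsets by [1 - m/M], at most
    [1 - m/n <= a]. Hence a sample misses [o] given elements with probability at most [a ^+ o]. *)
Lemma bin_sub_le_exp (R : realType) (a : R) (n N m o : nat) :
  0 <= a -> (n%:R - m%:R <= a * n%:R) -> (0 < n)%N -> (N <= n)%N ->
  'C(N - o, m)%:R <= a ^+ o * 'C(N, m)%:R.
Proof.
move=> a0 ha n0 Nn; elim: o => [|o IH]; first by rewrite subn0 mul1r.
rewrite subnS exprS -mulrA.
apply: le_trans (_ : a * 'C(N - o, m)%:R <= _); last exact: ler_wpM2l.
set M := (N - o)%N; have Mn : (M <= n)%N by rewrite (leq_trans (leq_subr _ _)).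
(* Truncated subtraction: once the pool is empty, its size stays 0. The count is then nonzero only
   for [m = 0], where the hypothesis forces [1 <= a]. *)
have [M0|M0] := posnP M.
  rewrite M0 /=; case: m ha {IH} => [|m] ha; last by rewrite bin0n mulr0.
  rewrite bin0 mulr1; move: ha; rewrite subr0 -subr_le0 -{1}(mul1r n%:R) -mulrBl.
  by rewrite pmulr_lle0 ?ltr0n // subr_le0.
rewrite -(ler_pM2l (_ : 0 < M%:R :> R)) ?ltr0n // -natrM mul_bin_down natrM mulrA.
have [lt|le] := ltnP M m; first by rewrite bin_small // !mulr0.
rewrite ler_wpM2r // natrB //.
have : (M%:R <= n%:R :> R) by rewrite ler_nat.
have : (0 <= M%:R :> R) by [].
have : (0 <= m%:R :> R) by [].
have : (0 < n%:R :> R) by rewrite ltr0n.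
have [a1|a1] := leP a 1; [nra|].
by move=> *; nra.
Qed.

(** The increments [a ^+ p * (1 - a)] of [1 - a ^+ p] decrease, so this function of [p] lies above
    its chord on [[0, k]]. The inner [step] compares the next increment with the average of the
    first [p]. *)
Lemma geometric_concave (R : realType) (a : R) (o k : nat) :
  0 <= a <= 1 -> (o <= k)%N -> o%:R * (1 - a ^+ k) <= k%:R * (1 - a ^+ o).
Proof.
move=> /andP[a0 a1] ok.
have step p : p%:R * a ^+ p * (1 - a) <= 1 - a ^+ p.
  elim: p => [|p IH]; first by rewrite !mul0r expr0 subrr.
  rewrite exprS -(natr1 p); have p0 : 0 <= p%:R * a ^+ p * (1 - a).
    by rewrite !mulr_ge0 ?exprn_ge0 ?subr_ge0.
  have q0 : 0 <= a ^+ p by rewrite exprn_ge0.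
  have : a ^+ p <= 1 by rewrite exprn_ile1.
  move: IH p0 q0; set q := a ^+ p; set P := p%:R * q * (1 - a).
  have -> : (p%:R + 1) * (a * q) * (1 - a) = a * P + a * q * (1 - a) by rewrite /P; ring.
  move=> IH _ q0 q1; have aq : a * q <= 1 by rewrite mulr_ile1.
  have : 0 <= a * (1 - q - P) by rewrite mulr_ge0 // subr_ge0.
  have : 0 <= (1 - a) * (1 - a * q) by rewrite mulr_ge0 ?subr_ge0.
  lra.
elim: k ok => [|k IH]; first by rewrite leqn0 => /eqP->.
rewrite leq_eqVlt => /orP[/eqP->//|]; rewrite ltnS => ok.
have := IH ok; have := step o; rewrite exprS -(natr1 k).
have : a ^+ k <= a ^+ o by rewrite ler_wiXn2l.
have : 0 <= o%:R * (1 - a) by rewrite mulr_ge0 ?subr_ge0.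
move=> h1 h2 h3 h4.
have : o%:R * (1 - a) * a ^+ k <= o%:R * (1 - a) * a ^+ o by rewrite ler_wpM2l.
lra.
Qed.

(** * Symmetry of uniform sampling *)

Lemma tperm_imset_id (T : finType) (x y : T) (W : {set T}) :
  x \in W -> y \in W -> tperm x y @: W = W.
Proof.
move=> xW yW; apply/eqP; rewrite eqEcard card_imset ?leqnn ?andbT.
  2: exact: perm_inj.
by apply/subsetP => _ /imsetP[z zW ->]; case: tpermP.
Qed.

(** Transposing [x] and [y] permutes the samples and fixes [O], hence keeps the size of
    [S :&: O]. *)
Lemma sum_samples_sym (R : realType) (V : finType) (m : nat) (A O : {set V})
    (F : nat -> R) (x y : V) :
  O \subset ~: A -> x \in O -> y \in O ->
  \sum_(S in samples m A | x \in S) F #|S :&: O|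
    = \sum_(S in samples m A | y \in S) F #|S :&: O|.
Proof.
move=> OA xO yO; have pI := @perm_inj _ (tperm x y).
rewrite (reindex_inj (imset_inj pI)); apply: eq_big => S.
  rewrite !inE card_imset // -[in RHS](mem_imset _ _ pI) tpermR.
  rewrite -{1}(tperm_imset_id (subsetP OA _ xO) (subsetP OA _ yO)).
  congr (_ && _ && _); apply/subsetP/subsetP => H z.
    by move=> zS; have := H _ (imset_f (tperm x y) zS); rewrite mem_imset.
  by case/imsetP => u /H uA ->; rewrite mem_imset.
by rewrite -{1}(tperm_imset_id xO yO) -imsetI ?card_imset //; move=> ? ? _ _; apply: pI.
Qed.

(** * Expectations over runs, by conditioning on the past *)

Lemma big_tupleS (R : realType) (T : finType) (n : nat) (F : seq T -> R) :
  \sum_(t : n.+1.-tuple T) F t = \sum_(t : n.-tuple T) \sum_(x : T) F (x :: t).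
Proof.
rewrite pair_big /= (reindex (fun p : n.-tuple T * T => [tuple of p.2 :: p.1])) //=.
exists (fun t : n.+1.-tuple T => ([tuple of behead t], thead t)).
  by move=> [t x] _ /=; congr (_, _); apply: val_inj.
by move=> t _; rewrite /= [RHS]tuple_eta; apply: val_inj.
Qed.

(** The conditional expectation given the past [h]. The function [phi] is free because both [f] and
    its value on the union with the optimal set are followed. *)
Definition step_mean (R : realType) (V : finType) (f : {set V} -> R) (m : nat)
    (tb : history V -> {set V} -> V -> R) (h : history V)
    (phi : {set V} -> R) : R :=
  let A := current_set f h in
  \sum_(B : {set V}) \sum_(a : V)
    (B \in samples m A)%:R / #|samples m A|%:R * tb h B a
      * phi (greedy_step f A a).

Definition greedy_mean (R : realType) (V : finType) (f : {set V} -> R) (m : nat)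
    (tb : history V -> {set V} -> V -> R) (i : nat)
    (phi : {set V} -> R) : R :=
  \sum_(h : i.-tuple ({set V} * V)%type)
    history_prob f m tb h * phi (current_set f h).

Lemma greedy_mean0 (R : realType) (V : finType) (f : {set V} -> R) (m : nat)
    (tb : history V -> {set V} -> V -> R) (phi : {set V} -> R) :
  greedy_mean f m tb 0 phi = phi set0.
Proof.
rewrite /greedy_mean (big_pred1 [tuple]) ?mul1r // => t.
by apply/esym/eqP/tuple0.
Qed.

Lemma greedy_meanS (R : realType) (V : finType) (f : {set V} -> R) (m : nat)
    (tb : history V -> {set V} -> V -> R) (i : nat) (phi : {set V} -> R) :
  greedy_mean f m tb i.+1 phi =
  \sum_(h : i.-tuple ({set V} * V)%type)
    history_prob f m tb h * step_mean f m tb h phi.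
Proof.
rewrite /greedy_mean.
rewrite (big_tupleS _ (fun h => history_prob f m tb h * phi (current_set f h))).
apply: eq_bigr => h _; rewrite /step_mean pair_big mulr_sumr; apply: eq_bigr => -[B a] _ /=.
by rewrite !mulrA.
Qed.

Lemma sample_neq0 (V : finType) (m : nat) (A S : {set V}) :
  (0 < m)%N -> S \in samples m A -> S != set0.
Proof.
by move=> m0; rewrite inE -card_gt0 => /andP[_ /eqP->].
Qed.

Lemma history_prob_ge0 (R : realType) (V : finType) (f : {set V} -> R) (m : nat)
    (tb : history V -> {set V} -> V -> R) (h : history V) :
  (0 < m)%N -> tie_breaking f tb -> 0 <= history_prob f m tb h.
Proof.
move=> m0 tbP; elim: h => [|[B a] h IH] //=.
have [BO|] := boolP (B \in samples m _); last by rewrite mul0r mulr0 mul0r.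
have [tb0 _ _] := tbP h B (sample_neq0 m0 BO).
by rewrite !mulr_ge0 // invr_ge0.
Qed.

Lemma card_current_set (R : realType) (V : finType) (f : {set V} -> R)
    (h : history V) : (#|current_set f h| <= size h)%N.
Proof.
elim: h => [|[B a] h IH] /=; first by rewrite cards0.
rewrite /greedy_step; case: ifP => _; last exact: leqW.
by rewrite cardsU1 (leq_add (leq_b1 _) IH).
Qed.

Lemma greedy_step_ge (R : realType) (V : finType) (f : {set V} -> R)
    (A : {set V}) (a : V) : f A <= f (greedy_step f A a).
Proof.
by rewrite /greedy_step /gain; case: ifP => // /ltW; rewrite subr_ge0.
Qed.

(** If the best gain is not positive, the step is rejected; its increment 0 still dominates every
    sampled gain. *)
Lemma greedy_step_argmax (R : realType) (V : finType) (f : {set V} -> R)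
    (A S : {set V}) (a x : V) :
  a \in argmax_gain f A S -> x \in S ->
  gain f A x <= f (greedy_step f A a) - f A.
Proof.
rewrite inE => /andP[_ /forall_inP amax] /amax /le_trans; apply.
rewrite /greedy_step; case: ifP => // /negbT.
by rewrite -leNgt subrr.
Qed.

Lemma step_mean_sample (R : realType) (V : finType) (f : {set V} -> R) (m : nat)
    (tb : history V -> {set V} -> V -> R) (h : history V)
    (phi : {set V} -> R) :
  let A := current_set f h in
  step_mean f m tb h phi =
  (\sum_(B in samples m A) \sum_(a : V) tb h B a * phi (greedy_step f A a))
    / #|samples m A|%:R.
Proof.
rewrite /step_mean [in RHS]big_mkcond mulr_suml; apply: eq_bigr => B _.
case: ifP => _; last by rewrite mul0r big1 // => a _; rewrite !mul0r.
by rewrite mulr_suml; apply: eq_bigr => a _; rewrite mul1r -mulrA mulrC.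
Qed.

(** * One-step estimates *)

(** The weight [w x] of each gain is constant on [O] by symmetry, and the weights add up to the
    number of samples hitting [O]. A sample missing [O] contributes 0. *)
Lemma hitting_mean (R : realType) (V : finType) (m : nat) (A O : {set V})
    (g : V -> R) :
  O \subset ~: A ->
  (\sum_(S in samples m A) (\sum_(x in S :&: O) g x) / #|S :&: O|%:R) * #|O|%:R
  = (\sum_(x in O) g x)
    * (#|samples m A|%:R - 'C(#|~: A| - #|O|, m)%:R).
Proof.
move=> OA.
pose w x : R := \sum_(S in samples m A | x \in S) #|S :&: O|%:R^-1.
have wE x y : x \in O -> y \in O -> w x = w y.
  by move=> xO yO; exact: (sum_samples_sym m (fun n => n%:R^-1 : R) OA xO yO).
have -> : \sum_(S in samples m A) (\sum_(x in S :&: O) g x) / #|S :&: O|%:R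
    = \sum_(x in O) g x * w x.
  under eq_bigr do rewrite mulr_suml.
  under [RHS]eq_bigr do rewrite mulr_sumr.
  rewrite (exchange_big_dep (fun x => x \in O)) /=; last first.
    by move=> S x _; rewrite inE => /andP[].
  apply: eq_bigr => x xO; apply: eq_bigl => S.
  by rewrite [x \in _ :&: _]inE xO andbT.
have sw : \sum_(x in O) w x = #|samples m A|%:R - 'C(#|~: A| - #|O|, m)%:R.
  rewrite -card_samples_avoid // -(cardsID [set S : {set V} | [disjoint S & O]]).
  rewrite (_ : _ :&: _ = [set S in samples m A | [disjoint S & O]]); last first.
    by apply/setP => S; rewrite !inE.
  rewrite natrD addrC addKr /w.
  rewrite (exchange_big_dep (mem (samples m A))) //=; last first.
    by move=> x S _ /andP[].
  rewrite -sum1_card natr_sum [LHS]big_mkcond [RHS]big_mkcond /=.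
  apply: eq_bigr => S _; rewrite [S \in _ :\: _]inE andbC.
  case: (S \in samples m A) => //=.
  rewrite (eq_bigl (fun x => x \in S :&: O)) /=; last first.
    by move=> x; rewrite inE andbC.
  rewrite sumr_const inE -setI_eq0; case: eqVneq => [->|n0] /=.
    by rewrite cards0.
  by rewrite -[_ *+ _]mulr_natr mulVf // pnatr_eq0 cards_eq0.
have [->|[x xO]] := set_0Vmem O.
  by rewrite !big_set0 cards0 mulr0 mul0r.
have wx : {in O, forall y, w y = w x} by move=> y yO; apply: wE.
rewrite -sw (eq_bigr _ wx) (eq_bigr (fun y => g y * w x)); last first.
  by move=> y yO; rewrite wx.
by rewrite -mulr_suml sumr_const -[w x *+ _]mulr_natr mulrA.
Qed.

Lemma step_mean_value (R : realType) (V : finType) (f : {set V} -> R) (m : nat)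
    (tb : history V -> {set V} -> V -> R) (h : history V) (O : {set V}) (c : R) :
  let A := current_set f h in
  submodular f -> tie_breaking f tb -> 0 <= c -> (0 < m <= #|~: A|)%N ->
  (forall o, (o <= #|O|)%N ->
    'C(#|~: A| - o, m)%:R <= (1 - c * o%:R) * 'C(#|~: A|, m)%:R :> R) ->
  f A + c * (f (O :|: A) - f A) <= step_mean f m tb h f.
Proof.
move=> A fS tbP c0 /andP[m0 mA] hit.
have Om0 : 0 < #|samples m A|%:R :> R by rewrite ltr0n card_samples bin_gt0.
pose O' := O :\: A.
have O'A : O' \subset ~: A by rewrite /O' setDE subsetIr.
(* The best sampled gain is at least the average over the sampled part of [O']. If that part is
   empty, [Z B] is 0 and the bound only says that a step never decreases [f]. *)
pose Z (B : {set V}) : R := (\sum_(x in B :&: O') gain f A x) / #|B :&: O'|%:R.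
have stepZ B a : B \in samples m A -> tb h B a != 0 ->
    f A + Z B <= f (greedy_step f A a).
  move=> /(sample_neq0 m0) B0; have [_ _ tbmax] := tbP h B B0 => /tbmax amax.
  rewrite addrC -lerBrDr /Z.
  have [->|n0] := posnP #|B :&: O'|.
    by rewrite invr0 mulr0 subr_ge0 greedy_step_ge.
  rewrite ler_pdivrMr ?ltr0n // mulr_natr -sumr_const ler_sum // => x.
  by rewrite inE => /andP[xB _]; apply: greedy_step_argmax xB.
have mean0 : f A <= step_mean f m tb h f /\
    f A + (\sum_(B in samples m A) Z B) / #|samples m A|%:R
      <= step_mean f m tb h f.
  rewrite step_mean_sample -/A.
  split; rewrite ler_pdivlMr // ?mulrDl ?divfK ?gt_eqF // mulr_natr -sumr_const.
    apply: ler_sum => B BO; have [tb0 tb1 _] := tbP h B (sample_neq0 m0 BO).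
    rewrite -[f A]mul1r -tb1 mulr_suml; apply: ler_sum => a _.
    by rewrite ler_wpM2l // greedy_step_ge.
  rewrite -big_split /=; apply: ler_sum => B BO.
  have [tb0 tb1 _] := tbP h B (sample_neq0 m0 BO).
  rewrite -[f A + _]mul1r -tb1 mulr_suml; apply: ler_sum => a _.
  have [->|tbn0] := eqVneq (tb h B a) 0; first by rewrite !mul0r.
  by rewrite ler_wpM2l // stepZ.
have leG : f (O :|: A) - f A <= \sum_(x in O') gain f A x.
  have <- : O' :|: A = O :|: A.
    by apply/setP => x; rewrite !inE; case: (x \in A); rewrite ?orbT.
  exact: submodular_gain_sum.
case: mean0 => meanA meanZ.
(* The hitting probability is only bounded below, so it may be used only when the total gain over
   [O'] is nonnegative. Otherwise monotonicity of the run suffices. *)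
have [D0|D0] := leP (f (O :|: A) - f A) 0.
  by apply: le_trans meanA; rewrite gerDl mulr_ge0_le0.
apply: le_trans meanZ; rewrite lerD2l.
have G0 := lt_le_trans D0 leG.
have O'0 : 0 < #|O'|%:R :> R.
  rewrite ltr0n card_gt0; apply: contraTneq G0 => ->.
  by rewrite big_set0 ltxx.
apply: le_trans (_ : c * \sum_(x in O') gain f A x <= _).
  exact: ler_wpM2l.
rewrite ler_pdivlMr // -(ler_pM2r O'0) hitting_mean //.
rewrite mulrAC -!mulrA mulrCA; apply: ler_wpM2l; first exact: ltW.
have := hit _ (subset_leq_card (subsetDl O A : O' \subset O)).
rewrite -card_samples; lra.
Qed.

(** An element can be picked only if it is sampled, and then with conditional probability at most
    1. *)
Lemma pick_prob_le (R : realType) (V : finType) (f : {set V} -> R) (m : nat)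
    (tb : history V -> {set V} -> V -> R) (h : history V) (x : V) :
  let A := current_set f h in
  tie_breaking f tb -> (0 < m <= #|~: A|)%N ->
  \sum_(B in samples m A) tb h B x / #|samples m A|%:R <= m%:R / #|~: A|%:R.
Proof.
move=> A tbP /andP[m0 mA].
have Om0 : 0 < #|samples m A|%:R :> R by rewrite ltr0n card_samples bin_gt0.
have N0 : 0 < #|~: A|%:R :> R by rewrite ltr0n (leq_trans m0).
have memB B : B \in samples m A -> tb h B x != 0 -> x \in B.
  move=> /(sample_neq0 m0) B0; have [_ _ tbmax] := tbP h B B0.
  by move=> /tbmax; rewrite inE => /andP[].
rewrite -mulr_suml ler_pdivrMr // mulrAC ler_pdivlMr //.
have [xA|xA] := boolP (x \in ~: A); last first.
  rewrite big1 ?mul0r ?mulr_ge0 // => B BO; apply/eqP; apply: contraNT xA => n0.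
  by move: (BO); rewrite inE => /andP[/subsetP BA _]; apply/BA/memB.
rewrite -natrM -(card_samples_mem _ xA) natrM ler_wpM2r //.
rewrite -sum1_card natr_sum big_mkcond [leRHS]big_mkcond /=.
apply: ler_sum => B _.
rewrite (in_set (fun S => (S \in samples m A) && (x \in S))).
case: ifP => //= BO; have [tb0 tb1 _] := tbP h B (sample_neq0 m0 BO).
case: ifP => [xB|/negbT xB].
  by rewrite -tb1 (bigD1 x) //= lerDl sumr_ge0.
by rewrite le_eqVlt; apply/orP; left; apply: contraNT xB; apply: memB.
Qed.

(** Only the set [N] of elements with negative gain can hurt, each with weight at most [p]. Their
    gains sum to at least [f (N :|: B) - f B >= - f B]. The alternative [Y x = f B] covers rejected
    steps. *)
Lemma submodular_random_add (R : realType) (V : finType) (f : {set V} -> R)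
    (B : {set V}) (p : R) (q : V -> R) (Y : V -> R) :
  (forall S, 0 <= f S) -> submodular f ->
  (forall x, 0 <= q x <= p) -> \sum_x q x = 1 ->
  (forall x, Y x = f B \/ Y x = f (x |: B)) ->
  (1 - p) * f B <= \sum_x q x * Y x.
Proof.
move=> f0 fS qP q1 YP.
pose N := [set x | gain f B x < 0].
apply: le_trans (_ : f B + p * \sum_(x in N) gain f B x <= _).
  have [x0 _] : exists x : V, true.
    case: (pickP (fun _ : V => true)) => [x _|V0]; first by exists x.
    by move: q1 (oner_neq0 R); rewrite big_pred0 // => <-; rewrite eqxx.
  have p0 : 0 <= p by have /andP[/le_trans] := qP x0; apply.
  have : p * (f (N :|: B) - f B) <= p * \sum_(x in N) gain f B x.
    by rewrite ler_wpM2l // submodular_gain_sum.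
  have : 0 <= p * f (N :|: B) by rewrite mulr_ge0.
  lra.
rewrite -[f B]mul1r -q1 mulr_suml mulr_sumr [X in _ + X]big_mkcond.
rewrite -big_split /=.
apply: ler_sum => x _; have /andP[q0 qp] := qP x; rewrite inE.
have e : f (x |: B) = f B + gain f B x by rewrite addrC subrK.
by case: (YP x) => ->; rewrite ?e; case: ltP => g0; nra.
Qed.

Lemma step_mean_union (R : realType) (V : finType) (f : {set V} -> R) (m : nat)
    (tb : history V -> {set V} -> V -> R) (h : history V) (O : {set V}) :
  let A := current_set f h in
  (forall S, 0 <= f S) -> submodular f -> tie_breaking f tb ->
  (0 < m <= #|~: A|)%N ->
  (1 - m%:R / #|~: A|%:R) * f (O :|: A)
    <= step_mean f m tb h (fun S => f (O :|: S)).
Proof.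
move=> A f0 fS tbP mP; have /andP[m0 mA] := mP.
have Om0 : 0 < #|samples m A|%:R :> R by rewrite ltr0n card_samples bin_gt0.
rewrite step_mean_sample exchange_big mulr_suml /= -/A.
pose q x := \sum_(B in samples m A) tb h B x / #|samples m A|%:R.
rewrite (eq_bigr (fun x => q x * f (O :|: greedy_step f A x))); last first.
  by move=> x _; rewrite /q !mulr_suml; apply: eq_bigr => B _; rewrite mulrAC.
apply: submodular_random_add => //.
- move=> x; rewrite pick_prob_le // andbT sumr_ge0 // => B BO.
  by have [tb0 _ _] := tbP h B (sample_neq0 m0 BO); rewrite mulr_ge0 ?invr_ge0.
- rewrite exchange_big /= (eq_bigr (fun=> #|samples m A|%:R^-1)).
    by rewrite sumr_const -[_ *+ _]mulr_natr mulVf // gt_eqF.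
  move=> B BO; have [_ tb1 _] := tbP h B (sample_neq0 m0 BO).
  by rewrite -mulr_suml tb1 mul1r.
- move=> x; rewrite /greedy_step; case: ifP => _; last by left.
  by right; rewrite setUCA.
Qed.


(** * Recurrences in expectation and numerical bounds *)

(** Two functions [psi] and [chi] are allowed because the recurrence for the mean of [f] also
    involves the mean of its value on the union with the optimal set. *)
Lemma greedy_meanS_ge (R : realType) (V : finType) (f : {set V} -> R) (m : nat)
    (tb : history V -> {set V} -> V -> R) (i : nat) (phi : {set V} -> R)
    (x y : R) (psi chi : {set V} -> R) :
  (0 < m)%N -> tie_breaking f tb ->
  (forall h : history V, size h = i ->
    x * psi (current_set f h) + y * chi (current_set f h)
      <= step_mean f m tb h phi) ->
  x * greedy_mean f m tb i psi + y * greedy_mean f m tb i chi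
    <= greedy_mean f m tb i.+1 phi.
Proof.
move=> m0 tbP H; rewrite greedy_meanS !mulr_sumr -big_split /=.
apply: ler_sum => h _; rewrite mulrCA [y * _]mulrCA -mulrDr.
by rewrite ler_wpM2l ?history_prob_ge0 // H // size_tuple.
Qed.

Lemma expr_sub_ge (R : realType) (a b d : R) (i : nat) :
  0 <= a <= 1 -> 0 <= b <= 1 -> 0 <= d -> a - d <= b ->
  a ^+ i - i%:R * d <= b ^+ i.
Proof.
move=> /andP[a0 a1] /andP[b0 b1] d0 ab; elim: i => [|i IH].
  by rewrite !expr0 mul0r subr0.
rewrite !exprS -(natr1 i).
have p0 : 0 <= b ^+ i by rewrite exprn_ge0.
have p1 : b ^+ i <= 1 by rewrite exprn_ile1.
have : (a - d) * b ^+ i <= b * b ^+ i by rewrite ler_wpM2r.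
have : a * (a ^+ i - i%:R * d) <= a * b ^+ i by rewrite ler_wpM2l.
have : d * b ^+ i <= d by rewrite ler_piMr.
have : a * (i%:R * d) <= i%:R * d by rewrite ler_piMl // mulr_ge0.
lra.
Qed.

Lemma one_subV_exp_le (R : realType) (L : R) (k : nat) :
  (0 < k)%N -> L <= k%:R -> (1 - L / k%:R) ^+ k <= expR (- L).
Proof.
move=> k0 Lk; have kR : 0 < k%:R :> R by rewrite ltr0n.
have -> : - L = k%:R * (- (L / k%:R)).
  by rewrite mulrN mulrCA divff ?mulr1 // gt_eqF.
rewrite expRM_natl lerXn2r ?nnegrE ?expR_ge0 ?expR_ge1Dx //.
by rewrite subr_ge0 ler_pdivrMr // mul1r.
Qed.

(** Writing [expR L] as a power with exponent [k.-1], it suffices that [(1 - L/k) * (1 + L/(k-1))]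
    is at least 1; it equals [1 + L(1-L)/((k-1)k)]. In the proof [k] is renamed to its
    predecessor. *)
Lemma one_subV_exp_ge (R : realType) (L : R) (k : nat) :
  (1 < k)%N -> 0 <= L <= 1 -> expR (- L) <= (1 - L / k%:R) ^+ k.-1.
Proof.
case: k => // k; rewrite ltnS => k0 /andP[L0 L1] /=.
have kR : 0 < k%:R :> R by rewrite ltr0n.
have k1R : 0 < k.+1%:R :> R by rewrite ltr0n.
have LE : expR L = expR (L / k%:R) ^+ k.
  by rewrite -expRM_natl mulrCA divff ?mulr1 // gt_eqF.
rewrite expRN -[_^-1]mul1r ler_pdivrMr ?expR_gt0 // LE -exprMn.
apply: exprn_ege1.
have a0 : 0 <= 1 - L / k.+1%:R.
  by rewrite subr_ge0 ler_pdivrMr // mul1r (le_trans L1) // ler1n.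
apply: le_trans (_ : (1 - L / k.+1%:R) * (1 + L / k%:R) <= _); last first.
  by rewrite ler_wpM2l // expR_ge1Dx.
have -> : (1 - L / k.+1%:R) * (1 + L / k%:R)
    = 1 + L * (1 - L) / (k%:R * k.+1%:R).
  rewrite -natr1; field; rewrite natr1; apply/andP; split; exact: lt0r_neq0.
by rewrite lerDl divr_ge0 ?mulr_ge0 ?subr_ge0 // ltW.
Qed.

Lemma sample_sizeP (R : realType) (n k : nat) (eps : R) :
  0 < n%:R / k%:R * ln (1 / eps) ->
  [/\ (0 < sample_size n k eps)%N,
      n%:R / k%:R * ln (1 / eps) <= (sample_size n k eps)%:R
    & (sample_size n k eps)%:R < n%:R / k%:R * ln (1 / eps) + 1].
Proof.
rewrite /sample_size; set s := _ * ln _ => s0.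
have /andP[lt le] := ceil_itv s.
have c0 : 0 < Num.ceil s by rewrite -(ltr0z R) (lt_le_trans s0).
rewrite natr_absz gtr0_norm //; split=> //.
  by rewrite absz_gt0 gt_eqF.
by move: lt; rewrite intrD ltrBlDr.
Qed.

(** * Unrolling the two recurrences *)

Lemma greedy_bound (R : realType) (V : finType) (f : {set V} -> R) (k : nat)
    (Astar : {set V}) (tb : history V -> {set V} -> V -> R) (eps : R) :
  (forall S : {set V}, 0 <= f S) -> submodular f ->
  (2 <= k)%N -> (3 * k <= #|V|)%N -> (#|Astar| <= k)%N ->
  tie_breaking f tb -> 1 / expR 1 <= eps -> eps < 1 ->
  (eps - 2 * ((k%:R - 1) / (#|V|%:R - k%:R))) * (1 - eps) * f Astar
    <= expected_greedy_value f k eps tb.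
Proof.
move=> f0 fS k2 n3k Ak tbP eps_ge eps1.
have eps0 : 0 < eps by rewrite (lt_le_trans _ eps_ge) // divr_gt0 ?expR_gt0.
pose L := ln (1 / eps).
have epsE : eps = expR (- L).
  by rewrite /L div1r lnV ?posrE // opprK lnK ?posrE.
have L0 : 0 < L by rewrite /L ln_gt0 // div1r invf_gt1.
have L1 : L <= 1.
  by rewrite -ler_expR -[leRHS]invrK -(div1r (expR 1)) -[leLHS]invrK -expRN
     -epsE lef_pV2 // posrE divr_gt0 ?expR_gt0.
set n := #|V| in n3k *.
have kR : 2 <= k%:R :> R by rewrite (ler_nat _ 2).
have nR : 3 * k%:R <= n%:R :> R by rewrite -(natrM R 3) ler_nat.
have k0 : 0 < k%:R :> R by lra.
have nk0 : 0 < n%:R - k%:R :> R by lra.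
pose m := sample_size n k eps.
have [m0 sm ms] : [/\ (0 < m)%N, n%:R / k%:R * L <= m%:R
    & m%:R < n%:R / k%:R * L + 1].
  by apply: sample_sizeP; rewrite mulr_gt0 // divr_gt0 //; lra.
have Lk : 0 <= L / k%:R <= 2^-1.
  by apply/andP; split; [rewrite divr_ge0 //; lra|rewrite ler_pdivrMr //; lra].
pose a := 1 - L / k%:R; pose c := (1 - eps) / k%:R.
(* The numerator 2 absorbs two losses in the picking probability: less than 1 from the ceiling in
   [m], and [L <= 1] from the pool shrinking from [n] towards [n - k]. *)
pose d := 2 / (n%:R - k%:R) : R.
have a01 : 0 <= a <= 1 by rewrite /a; lra.
have c0 : 0 <= c by rewrite divr_ge0 //; lra.
have d0 : 0 <= d by rewrite divr_ge0 //; lra.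
have ak : a ^+ k <= eps.
  by rewrite epsE one_subV_exp_le //; [apply: ltnW|lra].
have ak1 : eps <= a ^+ k.-1 by rewrite epsE one_subV_exp_ge // L1 ltW.
have ac : a <= 1 - c.
  rewrite lerD2l lerN2 ler_pM2r ?invr_gt0 // epsE.
  by have := expR_ge1Dx (- L); lra.
have card_compl h : (size h < k)%N ->
    [/\ n%:R - k%:R <= #|~: current_set f h|%:R :> R,
       (m <= #|~: current_set f h|)%N & (#|~: current_set f h| <= n)%N].
  move=> hk; have := card_current_set f h => Ah.
  have AR : #|current_set f h|%:R <= k%:R :> R.
    by rewrite ler_nat (leq_trans Ah) // ltnW.
  have NE : #|~: current_set f h|%:R = n%:R - #|current_set f h|%:R :> R.
    by rewrite /n -(cardsC (current_set f h)) natrD addrC addKr.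
  split; rewrite ?max_card //; first by rewrite NE; lra.
  rewrite -(ler_nat R) NE; apply: le_trans (ltW ms) _.
  (* The sample fits in the pool: [n >= 3k] and [k >= 2] give [n/2 >= 3k/2 >= k + 1]. *)
  apply: le_trans (_ : n%:R / 2 + 1 <= _); last by lra.
  rewrite lerD2r -mulrA ler_pM2l; last by lra.
  by rewrite mulrC; lra.
have hit h o : (size h < k)%N -> (o <= #|Astar|)%N ->
    'C(#|~: current_set f h| - o, m)%:R
      <= (1 - c * o%:R) * 'C(#|~: current_set f h|, m)%:R :> R.
  move=> hk oA; have [_ _ Nn] := card_compl h hk.
  apply: le_trans (_ : a ^+ o * 'C(#|~: current_set f h|, m)%:R <= _).
    have /andP[a0 _] := a01.
    apply: bin_sub_le_exp Nn => //; last by rewrite -(ltr0n R); lra.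
    rewrite /a mulrBl mul1r lerD2l lerN2.
    by have -> : L / k%:R * n%:R = n%:R / k%:R * L by ring.
  rewrite ler_wpM2r // /c mulrAC.
  (* The chord bound with [a ^+ k <= eps] turns [1 - a ^+ o] into the linear lower bound [c * o]. *)
  have := geometric_concave a01 (leq_trans oA Ak) => conc.
  rewrite lerBrDl -lerBrDr ler_pdivrMr //.
  have : o%:R * (a ^+ k) <= o%:R * eps by rewrite ler_wpM2l.
  lra.
pose u i := greedy_mean f m tb i f.
pose v i := greedy_mean f m tb i (fun S => f (Astar :|: S)).
have uS i : (i < k)%N -> (1 - c) * u i + c * v i <= u i.+1.
  move=> ik; apply: greedy_meanS_ge => // h hi.
  have hk : (size h < k)%N by rewrite hi.
  have [_ mN _] := card_compl h hk.
  have := @step_mean_value R V f m tb h Astar c fS tbP c0.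
  rewrite m0 mN => /(_ isT (fun o => hit h o hk)).
  by apply: le_trans; rewrite /=; lra.
(* Truncation at 0 makes the factor nonnegative at once, as iterating [vS] requires. *)
pose b := Num.max 0 (a - d).
have b01 : 0 <= b <= 1 by rewrite /b le_max lexx ge_max ler01 /=; lra.
have vS i : (i < k)%N -> b * v i <= v i.+1.
  move=> ik; rewrite -[leLHS]addr0 -[X in _ + X](mul0r (v i)).
  apply: greedy_meanS_ge => // h hi; rewrite mul0r addr0.
  have hk : (size h < k)%N by rewrite hi.
  have [Nk mN Nn] := card_compl h hk.
  have := @step_mean_union R V f m tb h Astar f0 fS tbP.
  rewrite m0 mN => /(_ isT); apply: le_trans; apply: ler_wpM2r => //.
  have N0 : 0 < #|~: current_set f h|%:R :> R by lra.
  rewrite /b ge_max subr_ge0 ler_pdivrMr // mul1r ler_nat mN /=.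
  rewrite /a -addrA lerD2l -opprD lerN2 ler_pdivrMr //.
  apply: le_trans (ltW ms) _.
  apply: le_trans (_ : (L / k%:R + d) * (n%:R - k%:R) <= _); last first.
    by rewrite ler_wpM2l // addr_ge0 //; lra.
  rewrite mulrDl /d divfK ?lt0r_neq0 //.
  have -> : L / k%:R * (n%:R - k%:R) = n%:R / k%:R * L - L.
    by field; apply: lt0r_neq0.
  lra.
have v_ge i : (i <= k)%N -> b ^+ i * f Astar <= v i.
  elim: i => [|i IH] ik; first by rewrite /v greedy_mean0 setU0 mul1r.
  rewrite exprS -mulrA (le_trans _ (vS i ik)) // ler_wpM2l ?IH //; last exact: ltnW.
  by case/andP: b01.
pose D := (k%:R - 1) * d.
(* A single [D] replaces all losses [i * d] with [i <= k - 1]. At [i = 0] the factor [i%:R]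
   vanishes, so the truncated [i.-1] is harmless. *)
have u_ge i : (i <= k)%N -> c * i%:R * (a ^+ i.-1 - D) * f Astar <= u i.
  elim: i => [|i IH] ik; first by rewrite /u greedy_mean0 mulr0 !mul0r.
  apply: le_trans (uS i ik).
  have vi : (a ^+ i - D) * f Astar <= v i.
    apply: le_trans (v_ge i (ltnW ik)); rewrite ler_wpM2r //.
    have adb : a - d <= b by rewrite /b le_max lexx orbT.
    apply: le_trans (expr_sub_ge i a01 b01 d0 adb).
    by rewrite lerD2l lerN2 /D ler_wpM2r // lerBrDr natr1 ler_nat.
  have cv : c * ((a ^+ i - D) * f Astar) <= c * v i by rewrite ler_wpM2l.
  have ui : (1 - c) * (c * i%:R * (a ^+ i.-1 - D) * f Astar) <= (1 - c) * u i.
    by rewrite ler_wpM2l ?IH //; [lra|apply: ltnW].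
  apply: le_trans (lerD ui cv) => /=.
  have D0 : 0 <= D by rewrite mulr_ge0 //; lra.
  have cif : 0 <= c * i%:R * f Astar by rewrite mulr_ge0 // mulr_ge0.
  (* For positive [i], this follows from [a <= 1 - c] on the power and from [0 <= c * D] on the
     loss. *)
  suff : c * i%:R * f Astar * (a ^+ i - D)
      <= c * i%:R * f Astar * ((1 - c) * (a ^+ i.-1 - D)).
    by rewrite -(natr1 i); lra.
  case: i {IH ik vi cv ui} cif => [|i] cif; first by rewrite mulr0 !mul0r.
  rewrite ler_wpM2l // exprS /=.
  have ai : 0 <= a ^+ i by rewrite exprn_ge0; case/andP: a01.
  have : a * a ^+ i <= (1 - c) * a ^+ i by rewrite ler_wpM2r.
  have : 0 <= c * D by rewrite mulr_ge0.
  lra.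
apply: le_trans (u_ge k (leqnn k)).
rewrite ler_wpM2r // /c divfK ?lt0r_neq0 // mulrC ler_wpM2l //; first by rewrite subr_ge0 ltW.
have -> : D = 2 * ((k%:R - 1) / (n%:R - k%:R)) by rewrite /D /d; ring.
by rewrite lerD2r.
Qed.

Theorem theorem1 (R : realType) (V : finType) (f : {set V} -> R) (k : nat)
    (Astar : {set V}) (tb : history V -> {set V} -> V -> R)
    (f_ge0 : forall S : {set V}, 0 <= f S)
    (f_submod : submodular f)
    (k_ge2 : (2 <= k)%N)
    (n_ge3k : (3 * k <= #|V|)%N)
    (Astar_opt : optimal_solution f k Astar)
    (tbP : tie_breaking f tb) :
  (forall eps : R, 1 / expR 1 <= eps -> eps < 1 ->
     (eps - 2 * ((k%:R - 1) / (#|V|%:R - k%:R))) * (1 - eps) * f Astar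
       <= expected_greedy_value f k eps tb) /\
  1 / 4 * (1 - 2 * ((k%:R - 1) / (#|V|%:R - k%:R))) ^+ 2 * f Astar
    <= expected_greedy_value f k
         (1 / 2 + (k%:R - 1) / (#|V|%:R - k%:R)) tb.
Proof.
have bound eps := @greedy_bound R V f k Astar tb eps f_ge0 f_submod k_ge2
  n_ge3k (proj1 Astar_opt) tbP.
split=> [eps|]; first exact: bound.
have kR : 2 <= k%:R :> R by rewrite (ler_nat _ 2).
have nR : 3 * k%:R <= #|V|%:R :> R by rewrite -(natrM R 3) ler_nat.
set x := (k%:R - 1) / (#|V|%:R - k%:R).
have x0 : 0 <= x by rewrite divr_ge0 //; lra.
have x1 : x < 1 / 2 by rewrite ltr_pdivrMr; lra.
(* This parameter is the midpoint of the roots [2x] and 1 of [(eps - 2x)(1 - eps)], hence its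
   maximizer. It is admissible because [expR 1 >= 2] and [x < 1/2]. *)
apply: le_trans (bound (1 / 2 + x) _ _); last 2 first.
- apply: le_trans (_ : 1 / 2 <= _); last by lra.
  rewrite ler_pdivrMr ?expR_gt0 //.
  by have := expR_ge1Dx (1 : R); lra.
- lra.
have -> : 1 / 4 * (1 - 2 * x) ^+ 2 = (1 / 2 + x - 2 * x) * (1 - (1 / 2 + x)).
  by field.
exact: lexx.
Qed.
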